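(* Let $n$ be a positive integer. There exists an $8$-regular circulant nut graph of order $n$ if and only if $n$ is even and either $n=14$ or $n\geq 18$.
   Context: A circulant graph of order $n$ is a graph of the form $\mathrm{Circ}(n,S)$ with generator set $S\subseteq\{1,\dots,\lfloor n/2\rfloor\}$, i.e. the graph with vertex set $V=\{0,1,\dots,n-1\}$ in which $i$ is adjacent to $i\pm s$ (computed modulo $n$) for every $i\in V$ and $s\in S$. A simple graph with at least two vertices is a nut graph if its adjacency matrix has the eigenvalue $0$ with multiplicity exactly $1$ and an eigenvector corresponding to $0$ has no zero entries. *)

(* Defs.v *)
(* MathComp *)
From HB Require Import structures.
From mathcomp Require Import all_boot all_order all_algebra.

Set Implicit Arguments.
Unset Strict Implicit.
Unset Printing Implicit Defensive.

Import Order.TTheory GRing.Theory Num.Theory.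

Local Open Scope ring_scope.

(* Since n./2 < n for n > 0, {set 'I_n} accommodates every subset of
   {1, ..., n./2}. *)
Definition generator_set (n : nat) (S : {set 'I_n}) : Prop :=
  forall s : 'I_n, s \in S -> (0 < s <= n./2)%N.

(* Both disjuncts are read in nat: the first is j = i + s modulo n, and the
   second, i = j + s modulo n, is j = i - s modulo n without truncated
   subtraction. *)
Definition Circ (n : nat) (S : {set 'I_n}) : rel 'I_n :=
  fun i j => [exists s in S, ((j == i + s %[mod n]) || (i == j + s %[mod n]))%N].

Definition regular_graph (n d : nat) (e : rel 'I_n) : Prop :=
  forall i : 'I_n, #|[set j | e i j]| = d.

Definition adjmx (R : realFieldType) (n : nat) (e : rel 'I_n) : 'M[R]_n :=
  \matrix_(i, j) (e i j)%:R.

(* The adjacency matrix of a simple graph is symmetric, so its left and right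
   eigenvectors coincide up to transposition, and over a real field the
   algebraic multiplicity of the eigenvalue 0 is the dimension of its
   eigenspace. *)
Definition nut_graph (R : realFieldType) (n : nat) (e : rel 'I_n) : Prop :=
  [/\ symmetric e, irreflexive e, (2 <= n)%N,
      \rank (eigenspace (adjmx R e) 0) = 1%N
    & exists2 v : 'rV[R]_n,
        (v <= eigenspace (adjmx R e) 0)%MS & forall i, v 0 i != 0].

(* Main.v *)
(** Let [N] be the symmetric connection set [S :|: - S] in Z/n.

Necessity: the kernel is a real line stable under the cyclic shift, so it is spanned by
(c^i) with c = 1 or c = -1.  As the degree is not 0, c = -1; hence n is even and [N] has as
many even as odd elements.  For n = 10, 12, 16 every such [N] of size 8 also annihilates a
sparse vector, which contradicts the absence of zero entries.

Sufficiency: the graph is a nut graph as soon as -1 is the only n-th root of unity x with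
[\sum_(d in N) x ^+ d = 0].  For S = {a, a+1, a+p, a+p+1} this sum is, up to a power of x,
(x + 1) (x^p + 1) (x^(2a+p+1) + 1).  Write n = 2^e r with r odd.  Taking p = 2 and
2a+p+1 = n/2 - 2 when e = 1, and p = 2^e and 2a+p+1 = n/2 - 1 when e >= 2 and r >= 3, works.
If n = 2^e, take S = {1, 4, 7, 8}: for k >= 2 a root x of order 2^k has -x among its
conjugates, so x annihilates both the even and the odd part of the sum, which are coprime. *)
Require Import Defs.
From mathcomp Require Import all_boot all_order all_algebra all_field.
From mathcomp Require Import zify ring.

Section Circulant.

Set Implicit Arguments.
Unset Strict Implicit.
Unset Printing Implicit Defensive.

Import Order.TTheory GRing.Theory Num.Theory.
Local Open Scope ring_scope.

(** * Connection sets in Z/n, where n is [m.+1] *)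

Definition connection_set m (S : {set 'I_m.+1}) : {set 'I_m.+1} :=
  S :|: [set - s | s in S].

Lemma connection_setP m (S : {set 'I_m.+1}) (d : 'I_m.+1) :
  reflect (exists2 s, s \in S & d = s \/ d = - s) (d \in connection_set S).
Proof.
rewrite inE; apply: (iffP orP) => [[dS|/imsetP[s sS ->]]|[s sS [->|->]]].
- by exists d; [|left].
- by exists s; [|right].
- by left.
- by right; apply: imset_f.
Qed.

Lemma CircE m (S : {set 'I_m.+1}) (i j : 'I_m.+1) :
  Circ S i j = (j - i \in connection_set S).
Proof.
have modE (a b s : 'I_m.+1) : (a == b + s %[mod m.+1])%N = (a == b + s).
  by rewrite (modn_small (ltn_ord a)).
apply/existsP/connection_setP => [[s /andP[sS]]|[s sS sE]]; last first.
  exists s; rewrite sS /= !modE; case: sE => [<-|/(congr1 -%R)].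
  - by rewrite addrC subrK eqxx.
  - by rewrite opprB opprK => <-; rewrite [j + _]addrC subrK eqxx orbT.
rewrite !modE => /orP[]/eqP->; exists s => //.
- by left; rewrite addrC addKr.
- by right; rewrite opprD addNKr.
Qed.

Lemma connection_setN m (S : {set 'I_m.+1}) d :
  (- d \in connection_set S) = (d \in connection_set S).
Proof.
by apply/connection_setP/connection_setP => -[s sS sE]; exists s => //;
  case: sE => /(congr1 -%R); rewrite ?opprK; tauto.
Qed.

Lemma Circ_sym m (S : {set 'I_m.+1}) : symmetric (Circ S).
Proof. by move=> i j; rewrite !CircE -opprB connection_setN. Qed.

Lemma card_Circ m (S : {set 'I_m.+1}) (i : 'I_m.+1) :
  #|[set j | Circ S i j]| = #|connection_set S|.
Proof.
rewrite -(card_imset (mem (connection_set S)) (@addrI _ i)).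
apply: eq_card => j; rewrite inE CircE; apply/idP/imsetP => [jN|[d dN ->]].
  by exists (j - i); rewrite // addrC subrK.
by rewrite addrC addKr.
Qed.

(** As [uphalf m] is half of [m.+1] rounded down, two elements of [S] add up to less than [m.+1], so
    never to 0 in Z/n. *)
Lemma connection_set_disjoint m (S : {set 'I_m.+1}) :
  (forall s : 'I_m.+1, s \in S -> (0 < s < uphalf m)%N) ->
  [disjoint S & [set - s | s in S]].
Proof.
move=> Slt; apply/pred0Pn => -[s /andP[/= sS /imsetP[t tS sE]]].
have := Slt _ sS; have := Slt _ tS; rewrite !uphalfE => tlt slt.
have /(congr1 val) /= : s + t = 0 by rewrite sE addNr.
by rewrite modn_small; lia.
Qed.

Lemma card_connection_set m (S : {set 'I_m.+1}) :
  (forall s : 'I_m.+1, s \in S -> (0 < s < uphalf m)%N) ->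
  #|connection_set S| = #|S|.*2.
Proof.
move=> /connection_set_disjoint/disjoint_setI0 S0.
by rewrite cardsU S0 cards0 subn0 card_imset ?addnn //; exact: oppr_inj.
Qed.

(** * Powers of an n-th root of unity with exponents in Z/n *)

Section ExpOrd.
Variables (R : comUnitRingType) (m : nat) (x : R).
Hypothesis xn1 : x ^+ m.+1 = 1.

Lemma exprDord (a b : 'I_m.+1) : x ^+ (a + b)%R = x ^+ a * x ^+ b.
Proof. by rewrite /= expr_mod // exprD. Qed.

Lemma exprNord (a : 'I_m.+1) : x ^+ (- a)%R = x ^- a.
Proof.
have xu : x \is a GRing.unit.
  by apply/unitrPr; exists (x ^+ m); rewrite -exprS.
apply: (@mulrI _ (x ^+ a)); first by rewrite unitrX.
by rewrite -exprDord divrr ?unitrX // subrr.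
Qed.

Lemma sum_connection_set (S : {set 'I_m.+1}) :
  (forall s : 'I_m.+1, s \in S -> (0 < s < uphalf m)%N) ->
  \sum_(d in connection_set S) x ^+ d = \sum_(s in S) (x ^+ s + x ^- s).
Proof.
move=> /connection_set_disjoint dS.
rewrite (eq_bigl [predU S & [set - s | s in S]]) => [|d]; last by rewrite !inE.
rewrite bigU //= big_imset /=; last by move=> s t _ _; apply: oppr_inj.
by rewrite -big_split; apply: eq_bigr => s _; rewrite exprNord.
Qed.

End ExpOrd.

(** * Circulant matrices and a criterion for nut graphs *)

Definition circmx (F : fieldType) m (N : {set 'I_m.+1}) : 'M[F]_m.+1 :=
  \matrix_(i, j) (j - i \in N)%:R.

Lemma adjmx_Circ (R : realFieldType) m (S : {set 'I_m.+1}) :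
  adjmx R (Circ S) = circmx R (connection_set S).
Proof. by apply/matrixP=> i j; rewrite !mxE CircE. Qed.

Lemma map_circmx (F K : fieldType) (f : {rmorphism F -> K}) m
    (N : {set 'I_m.+1}) : map_mx f (circmx F N) = circmx K N.
Proof. by apply/matrixP=> i j; rewrite !mxE rmorph_nat. Qed.

Lemma mul_circmxE (F : fieldType) m (N : {set 'I_m.+1}) (v : 'rV[F]_m.+1) j :
  (v *m circmx F N) 0 j = \sum_(d in N) v 0 (j - d).
Proof.
rewrite mxE (reindex_inj (inv_inj (subKr j))) [RHS]big_mkcond.
by apply: eq_bigr => d _; rewrite mxE subKr mulr_natr mulrb.
Qed.

(** With vectors read as polynomials modulo X^n - 1, a circulant matrix acts by multiplication, and
    evaluation at an n-th root of unity is multiplicative. *)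
Lemma circmx_eval (F : fieldType) m (N : {set 'I_m.+1}) (v : 'rV[F]_m.+1) x :
  x ^+ m.+1 = 1 ->
  \sum_j (v *m circmx F N) 0 j * x ^+ j =
  (\sum_i v 0 i * x ^+ i) * \sum_(d in N) x ^+ d.
Proof.
move=> xn1; rewrite mulr_sumr.
under eq_bigr do rewrite mul_circmxE mulr_suml.
rewrite exchange_big; apply: eq_bigr => d _ /=.
rewrite mulr_suml (reindex_inj (addIr d)); apply: eq_bigr => i _.
by rewrite addrK -mulrA -exprDord.
Qed.

Definition altv (F : fieldType) m : 'rV[F]_m.+1 := \row_i (-1) ^+ i.

(** The sum is taken in [int] so that one hypothesis serves both [R] and [algC]. *)
Lemma mul_altv (F : fieldType) m (N : {set 'I_m.+1}) : ~~ odd m.+1 ->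
  \sum_(d in N) (-1) ^+ d = 0 :> int -> altv F m *m circmx F N = 0.
Proof.
move=> n_even sumN; apply/rowP => j; rewrite mul_circmxE mxE.
have n1 : (-1) ^+ m.+1 = 1 :> F by rewrite -signr_odd (negbTE n_even).
under eq_bigr do rewrite mxE exprDord // exprNord // -exprVn invrN1.
rewrite -mulr_sumr; have /(congr1 (fun z : int => z%:~R : F)) := sumN.
rewrite rmorph_sum /=.
by under eq_bigr do rewrite rmorphXn rmorphN1; move=> ->; rewrite mulr0.
Qed.

(* A kernel vector [v] with [v_0 = 0] is [X q] for a polynomial [q] of degree less than
   [n - 1] that vanishes at the [n - 1] roots of unity other than [-1]. *)
Lemma circmx_ker_eq0 m (N : {set 'I_m.+1}) (v : 'rV[algC]_m.+1) :
  ~~ odd m.+1 ->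
  (forall x : algC, x ^+ m.+1 = 1 -> \sum_(d in N) x ^+ d = 0 -> x = -1) ->
  v *m circmx _ N = 0 -> v 0 0 = 0 -> v = 0.
Proof.
move=> n_even rootN vN v0.
have [z zP] := C_prim_root_exists (ltn0Sn m).
pose q : {poly algC} := \poly_(i < m) v 0 (inord i.+1).
have qE x : x * q.[x] = \sum_i v 0 i * x ^+ i.
  rewrite big_ord_recl v0 mul0r add0r horner_poly mulr_sumr.
  apply: eq_bigr => i _; rewrite mulrCA -exprS; congr (v 0 _ * _).
  by apply/val_inj; rewrite /= inordK // ltnS.
pose us := [seq z ^+ (i : 'I_m.+1) | i : 'I_m.+1].
have us_uniq : uniq us.
  rewrite map_inj_uniq ?enum_uniq // => i j /eqP.
  by rewrite (eq_prim_root_expr zP) !modn_small // => /eqP/val_inj.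
pose rs := [seq x <- us | x != -1].
have q0 : q = 0.
  apply: (@roots_geq_poly_eq0 _ q rs); rewrite ?filter_uniq //.
    apply/allP => x; rewrite mem_filter => /andP[x1 /mapP[i _ xE]].
    have xn : x ^+ m.+1 = 1.
      by rewrite xE exprAC (prim_expr_order zP) expr1n.
    have x0 : x != 0 by apply: contra_eq_neq xn => ->; rewrite expr0n eq_sym oner_eq0.
    have := circmx_eval N v xn; rewrite vN big1 => [|j _]; last by rewrite mxE mul0r.
    rewrite -qE => /esym/eqP; rewrite !mulf_eq0 (negbTE x0) /= => /orP[//|/eqP].
    by move=> /(rootN _ xn) xE'; rewrite xE' eqxx in x1.
  (* [q] has size at most [m], and removing -1 from [m.+1] distinct roots leaves at least [m]. *)
  apply: (leq_trans (size_poly _ _)).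
  have := count_predC (pred1 (-1)) us; rewrite size_map size_enum_ord.
  by rewrite -(ltnS m) size_filter count_uniq_mem // => <-; case: (_ \in us).
apply/rowP => i; rewrite mxE; case: (unliftP 0 i) => [j ->|-> //].
have := congr1 (fun p : {poly algC} => p`_j) q0; rewrite coef_poly ltn_ord coef0 => <-.
by congr (v 0 _); apply/val_inj; rewrite /= inordK // ltnS.
Qed.

Lemma Circ_nut (R : realFieldType) m (S : {set 'I_m.+1}) :
  0 \notin S -> ~~ odd m.+1 ->
  \sum_(d in connection_set S) (-1) ^+ d = 0 :> int ->
  (forall x : algC, x ^+ m.+1 = 1 ->
     \sum_(d in connection_set S) x ^+ d = 0 -> x = -1) ->
  nut_graph R (Circ S).
Proof.
move=> S0 n_even sumN rootN.
have altA (F : fieldType) := mul_altv F n_even sumN.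
have alt0 (F : fieldType) i : altv F m 0 i != 0 by rewrite mxE signr_eq0.
have altn (F : fieldType) : altv F m != 0.
  by apply/eqP => alt0E; have := alt0 F 0; rewrite alt0E mxE eqxx.
have altE : (altv R m <= eigenspace (adjmx R (Circ S)) 0)%MS.
  by apply/eigenspaceP; rewrite adjmx_Circ altA scale0r.
split.
- exact: Circ_sym.
- move=> i; rewrite CircE subrr; apply/connection_setP => -[s sS [/esym s0|/esym s0]].
    by rewrite s0 (negbTE S0) in sS.
  by move/eqP: s0 sS; rewrite oppr_eq0 => /eqP->; rewrite (negbTE S0).
- by case: (m) n_even.
- apply/eqP; rewrite eqn_leq; apply/andP; split; last first.
    by have := mxrankS altE; rewrite rank_rV altn.
  (* The matrix is rational, so passing through [rat] its rank over [R] equals its rank over [algC],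
     where all roots of unity are available. *)
  rewrite /eigenspace raddf0 subr0 adjmx_Circ mxrank_ker.
  rewrite -(map_circmx (@ratr R)) mxrank_map -(mxrank_map (@ratr algC)) map_circmx.
  rewrite -mxrank_ker -[1%N]/(nat_of_bool true) -(altn algC) -rank_rV mxrankS //.
  apply/rV_subP => v /sub_kermxP vN; apply/sub_rVP; exists (v 0 0).
  apply/eqP; rewrite -subr_eq0; apply/eqP; apply: circmx_ker_eq0 rootN _ _ => //.
    by rewrite mulmxBl vN -scalemxAl altA scaler0 subr0.
  by rewrite !mxE mulr1 subrr.
- by exists (altv R m) => // i; exact: alt0.
Qed.

Lemma Circ_of_list_nut (R : realFieldType) n (l : seq nat) :
  ~~ odd n -> uniq l -> size l = 4 ->
  (forall s, s \in l -> (0 < s < n./2)%N) ->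
  \sum_(s <- l) (-1) ^+ s = 0 :> int ->
  (forall x : algC, x != 0 -> x ^+ n = 1 ->
     \sum_(s <- l) (x ^+ s + x ^- s) = 0 -> x = -1) ->
  exists S : {set 'I_n},
    [/\ generator_set S, regular_graph 8 (Circ S) & nut_graph R (Circ S)].
Proof.
case: n => [|m] n_even l_uniq l4 l_lt l_alt l_root.
  by case: l l4 l_lt {l_uniq l_alt l_root} => // s l _ /(_ s (mem_head _ _)); rewrite andbF.
pose S := [set s : 'I_m.+1 | (s : nat) \in l].
have S_lt (s : 'I_m.+1) : s \in S -> (0 < s < uphalf m)%N by rewrite inE => /l_lt.
have bigS (V : nmodType) (F : nat -> V) : \sum_(s in S) F s = \sum_(s <- l) F s.
  under eq_bigl do rewrite inE.
  rewrite -(big_mkord (fun s => s \in l)) -big_filter; apply: perm_big.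
  rewrite uniq_perm ?filter_uniq ?iota_uniq // => s.
  rewrite mem_filter mem_index_iota; case: (boolP (s \in l)) => // /l_lt; lia.
exists S; split.
- by move=> s /S_lt/andP[-> /ltnW].
- move=> i; rewrite card_Circ card_connection_set // -sum1_card.
  by rewrite (bigS _ (fun=> 1%N)) sum1_size l4.
apply: Circ_nut => //.
- by apply/negP => /S_lt.
- rewrite sum_connection_set //; last by rewrite -signr_odd (negbTE n_even).
  rewrite (bigS _ (fun s => (-1) ^+ s + (-1) ^- s)).
  by under eq_bigr do rewrite -exprVn invrN1; rewrite big_split /= l_alt.
- move=> x xn; rewrite sum_connection_set // (bigS _ (fun s => x ^+ s + x ^- s)).
  apply: l_root => //; apply: contra_eq_neq xn => ->.
  by rewrite expr0n eq_sym oner_eq0.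
Qed.

(** * Generators for each admissible order *)

(** The positive exponents contribute x^a (1 + x) (1 + x^p), the negative ones x^-(a+p+1) times the
    same two factors. *)
Lemma sum_consecutive_pairs (F : fieldType) (x : F) (a p : nat) : x != 0 ->
  x ^+ (a + p).+1 *
    \sum_(s <- [:: a; a.+1; a + p; (a + p).+1]%N) (x ^+ s + x ^- s) =
  (x + 1) * (x ^+ p + 1) * (x ^+ (a.*2 + p).+1 + 1).
Proof.
move=> x0; rewrite !big_cons big_nil -addnn !exprS !exprD.
have := expf_neq0 a x0; have := expf_neq0 p x0.
move: (x ^+ a) (x ^+ p) => y z z0 y0; field.
by rewrite x0 y0 z0.
Qed.

Lemma consecutive_pairs_nut (R : realFieldType) n a p :
  ~~ odd n -> (0 < a)%N -> (1 < p)%N -> ((a + p).+1 < n./2)%N ->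
  (forall x : algC, x ^+ n = 1 -> x ^+ p = -1 -> x = -1) ->
  (forall x : algC, x ^+ n = 1 -> x ^+ (a.*2 + p).+1 = -1 -> x = -1) ->
  exists S : {set 'I_n},
    [/\ generator_set S, regular_graph 8 (Circ S) & nut_graph R (Circ S)].
Proof.
move=> n_even a0 p1 lt_n p_root q_root.
apply: (@Circ_of_list_nut _ _ [:: a; a.+1; a + p; (a + p).+1]%N) => //.
- by rewrite /= !inE; lia.
- by move=> s; rewrite !inE; lia.
- by rewrite !big_cons big_nil !exprS; ring.
move=> x x0 xn sum0; have := sum_consecutive_pairs a p x0.
rewrite sum0 mulr0 => /esym/eqP; rewrite !mulf_eq0 !addr_eq0.
move=> /orP[/orP[/eqP//|/eqP]|/eqP]; [exact: p_root | exact: q_root].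
Qed.

(** The order of -x divides both n and q, hence is 1. *)
Lemma root_opp1_coprime (F : fieldType) n q (x : F) :
  (0 < n)%N -> ~~ odd n -> odd q -> coprime q n -> x ^+ n = 1 -> x ^+ q = -1 -> x = -1.
Proof.
move=> n0 n_even q_odd co_qn xn xq.
have yn : (- x) ^+ n = 1 by rewrite exprNn xn -signr_odd (negbTE n_even) mulr1.
have yq : (- x) ^+ q = 1 by rewrite exprNn xq -signr_odd q_odd mulrNN mulr1.
have [d d_prim dn] := prim_order_exists n0 yn.
have dq : (d %| q)%N by rewrite (prim_order_dvd d_prim) yq.
have d1 : d = 1%N.
  by apply/eqP; rewrite -dvdn1 -(eqP co_qn) dvdn_gcd dq.
by have := prim_expr_order d_prim; rewrite d1 expr1 => <-; rewrite opprK.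
Qed.

Lemma nut_order_2mod4 (R : realFieldType) m : odd m -> (7 <= m)%N ->
  exists S : {set 'I_m.*2},
    [/\ generator_set S, regular_graph 8 (Circ S) & nut_graph R (Circ S)].
Proof.
move=> m_odd m7.
have n_even : ~~ odd m.*2 by rewrite odd_double.
(* This [a] makes 2a + p + 1 equal to [m - 2], which is odd and coprime to [m.*2]; it is positive
   because [m] is at least 7. *)
apply: (@consecutive_pairs_nut _ _ ((m - 5)./2) 2) => //; try by lia.
- move=> x xn x2; have : x ^+ m.*2 = -1 by rewrite -mul2n exprM x2 -signr_odd m_odd.
  by move/eqP; rewrite xn eq_sym eqNr oner_eq0.
have -> : (((m - 5)./2).*2 + 2).+1 = (m - 2)%N by lia.
move=> x; apply: root_opp1_coprime => //; [lia|lia|].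
have co2 : coprime (m - 2) 2 by rewrite coprimen2; lia.
rewrite -mul2n coprimeMr co2 /=.
by rewrite -[X in coprime _ X](@subnK 2 m) ?(leq_trans _ m7) // /coprime gcdnDl.
Qed.

Lemma nut_order_two_power_mul (R : realFieldType) e r :
  odd r -> (3 <= r)%N -> (2 <= e)%N -> (20 <= 2 ^ e * r)%N ->
  exists S : {set 'I_(2 ^ e * r)},
    [/\ generator_set S, regular_graph 8 (Circ S) & nut_graph R (Circ S)].
Proof.
move=> r_odd r3 e2 n20.
have [h eE h1] : exists2 h, (2 ^ e = 4 * h)%N & (0 < h)%N.
  by exists (2 ^ (e - 2))%N; rewrite ?expn_gt0 // -(expnD 2 2) subnKC.
have n_even : ~~ odd (2 ^ e * r) by rewrite eE; lia.
have hr : (3 * h <= h * r)%N by rewrite mulnC leq_mul2l r3 orbT.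
(* Here n = 4hr and 2a + p + 1 = 2hr - 1, the predecessor of n/2. The bound 20 excludes h = 1, r =
   3, the only case where [a] would be 0. *)
apply: (@consecutive_pairs_nut _ _ (h * r - 1 - 2 * h) (2 ^ e)) => //.
- by nia.
- by lia.
- by nia.
- move=> x xn x2; have : x ^+ (2 ^ e * r) = -1 by rewrite exprM x2 -signr_odd r_odd.
  by move/eqP; rewrite xn eq_sym eqNr oner_eq0.
have -> : ((h * r - 1 - 2 * h).*2 + 2 ^ e).+1 = (2 * (h * r) - 1)%N by nia.
have -> : (2 ^ e * r = 2 * (2 * (h * r)))%N by nia.
move=> x; apply: root_opp1_coprime; [nia|lia|nia|].
have co2 : coprime (2 * (h * r) - 1) 2 by rewrite coprimen2; nia.
rewrite coprimeMr co2 /= subn1.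
by rewrite -{2}[(2 * (h * r))%N]prednK ?coprimenS //; nia.
Qed.

(* For [k >= 2] the conjugates of a primitive [2 ^ k]-th root of unity [z] include [- z]. *)
Lemma root_opp_two_power (p : {poly rat}) k (z : algC) :
  (2 <= k)%N -> (2 ^ k).-primitive_root z ->
  root (map_poly ratr p) z -> root (map_poly ratr p) (- z).
Proof.
move=> k2 z_prim.
have [h hE h_even] : exists2 h, (2 ^ k = 2 * h)%N & ~~ odd h.
  by exists (2 ^ k.-1)%N; [rewrite -expnS prednK | rewrite oddX; case: k k2 {z_prim} => [|[]]];
     lia.
have h0 : (0 < h)%N by have := prim_order_gt0 z_prim; lia.
have zh : z ^+ h = -1.
  have : (z ^+ h) ^+ 2 == 1 by rewrite -exprM mulnC -hE (prim_expr_order z_prim).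
  rewrite sqrf_eq1 -(prim_order_dvd z_prim) => /orP[|/eqP//].
  by rewrite hE => /dvdn_leq; lia.
have Nz_prim : (2 ^ k).-primitive_root (- z).
  (* The exponent [h.+1] is odd, so this power is again primitive. *)
  have -> : - z = z ^+ h.+1 by rewrite exprS zh mulrN1.
  by rewrite (prim_root_exp_coprime _ z_prim) coprimeXr // coprimen2 /= h_even.
have [q [qE _ ->]] := minCpolyP z; have [q' [q'E _ ->]] := minCpolyP (- z).
(* Both minimal polynomials are the cyclotomic polynomial of order [2 ^ k]. *)
suff -> : q = q' by [].
apply: (@map_poly_inj _ _ (@ratr algC)).
rewrite -qE -q'E (minCpoly_cyclotomic z_prim) (minCpoly_cyclotomic Nz_prim).
by rewrite -(Cintr_Cyclotomic z_prim) -(Cintr_Cyclotomic Nz_prim).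
Qed.

Lemma nut_order_two_power (R : realFieldType) e : (5 <= e)%N ->
  exists S : {set 'I_(2 ^ e)},
    [/\ generator_set S, regular_graph 8 (Circ S) & nut_graph R (Circ S)].
Proof.
move=> e5; have [h hE h0] : exists2 h, (2 ^ e = 32 * h)%N & (0 < h)%N.
  by exists (2 ^ (e - 5))%N; rewrite ?expn_gt0 // -(expnD 2 5) subnKC.
apply: (@Circ_of_list_nut _ _ [:: 1; 4; 7; 8]%N) => //.
- by rewrite hE; lia.
- by move=> s; rewrite !inE hE; lia.
- by rewrite !big_cons big_nil.
move=> x x0 xn; rewrite !big_cons big_nil => sum0.
(* [P] is X^8 times the sum, written as its even part plus its odd part. *)
pose P : {poly rat} := ('X^4 + 1) * ('X^12 + 1) + 'X * ('X^6 + 1) * ('X^8 + 1).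
have PE y : (map_poly ratr P).[y] =
    (y ^+ 4 + 1) * (y ^+ 12 + 1) + y * (y ^+ 6 + 1) * (y ^+ 8 + 1) :> algC.
  rewrite rmorphD !rmorphM !rmorphD !rmorph1 !rmorphXn /= map_polyX.
  by rewrite !(hornerE, hornerXn).
have Px : root (map_poly ratr P) x.
  rewrite /root PE; apply/eqP.
  rewrite -[RHS](mulr0 (x ^+ 8)) -sum0; field.
  exact: x0.
have [d d_prim /dvdn_pfactor[//|k _ dE]] := prim_order_exists (expn_gt0 2 e) xn.
rewrite dE in d_prim.
(* Orders 1 and 2 are treated directly: x = 1 gives the sum 8, and x = -1 is the claim. *)
have [k2|k2] := leqP 2 k; last first.
  have : (x ^+ 2) == 1 by rewrite -(prim_order_dvd d_prim) -[2%N]expn1 dvdn_exp2l.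
  rewrite sqrf_eq1 => /orP[/eqP x1|/eqP //].
  have /eqP : (8 : algC) = 0 by rewrite -[RHS]sum0 x1 !expr1n invr1; ring.
  by rewrite pnatr_eq0.
have := root_opp_two_power k2 d_prim Px; move: Px; rewrite /root !PE => /eqP P1 /eqP P2.
(* Adding and subtracting the values of [P] at x and -x isolates the even and odd parts. *)
have /eqP : (x ^+ 4 + 1) * (x ^+ 12 + 1) = 0.
  apply: (@mulfI _ 2); rewrite ?pnatr_eq0 // mulr0 -[RHS](addr0 0) -{1}P1 -P2; ring.
have /eqP : (x ^+ 6 + 1) * (x ^+ 8 + 1) = 0.
  apply: (@mulfI _ (2 * x)); rewrite ?mulf_neq0 ?pnatr_eq0 // mulr0.
  rewrite -[RHS](subr0 0) -{1}P1 -P2; ring.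
have N1 : (-1 : algC) != 1 by rewrite eqNr oner_eq0.
(* The four cases compute x^12, x^12, x^8 and x^24 in two ways, each giving -1 = 1. *)
rewrite !mulf_eq0 !addr_eq0 => /orP[]/eqP x6_8 /orP[]/eqP x4_12; case/eqP: N1.
- by transitivity (x ^+ 4 ^+ 3); [rewrite x4_12|rewrite -exprM (exprM x 6 2) x6_8]; ring.
- by rewrite -x4_12 (exprM x 6 2) x6_8 sqrrN expr1n.
- by rewrite -x6_8 (exprM x 4 2) x4_12 sqrrN expr1n.
- by transitivity (x ^+ 8 ^+ 3); [rewrite x6_8|rewrite -exprM (exprM x 12 2) x4_12]; ring.
Qed.

Lemma nut_order_sufficient (R : realFieldType) n :
  ~~ odd n -> n = 14 \/ (18 <= n)%N ->
  exists S : {set 'I_n},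
    [/\ generator_set S, regular_graph 8 (Circ S) & nut_graph R (Circ S)].
Proof.
move=> n_even n_ge; have [n2_odd|n2_even] := boolP (odd n./2).
  have -> : n = n./2.*2 by lia.
  by apply: nut_order_2mod4 => //; lia.
have n0 : (0 < n)%N by lia.
have [r r_odd nE] := pfactor_coprime (isT : prime 2) n0.
rewrite coprime2n in r_odd; move: nE n_ge; set e := logn 2 n.
rewrite mulnC => nE; rewrite nE => n_ge.
have e2 : (2 <= e)%N by rewrite -pfactor_dvdn //; lia.
have [r3|r_lt3] := leqP 3 r.
  (* A multiple of 4 that is at least 18 is at least 20. *)
  by apply: nut_order_two_power_mul => //; lia.
have r1 : r = 1%N by lia.
rewrite r1 muln1 in n_ge *; apply: nut_order_two_power.
rewrite ltnNge; apply/negP => e4.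
have : (2 ^ e <= 2 ^ 4)%N by rewrite leq_exp2l.
lia.
Qed.

(** * Necessary conditions on the order *)

Lemma nut_kernel (R : realFieldType) m (S : {set 'I_m.+1}) :
  nut_graph R (Circ S) ->
  exists v : 'rV[R]_m.+1,
    [/\ v *m circmx R (connection_set S) = 0, forall i, v 0 i != 0 &
        forall u, u *m circmx R (connection_set S) = 0 -> exists c, u = c *: v].
Proof.
case=> _ _ _; rewrite adjmx_Circ => rank1 [v vker v_neq0]; exists v; split=> //.
  by move/eigenspaceP: vker; rewrite scale0r.
move=> u uN; apply/sub_rVP.
have : (u <= eigenspace (circmx R (connection_set S)) 0)%MS.
  by apply/eigenspaceP; rewrite uN scale0r.
move=> /submx_trans; apply.
rewrite -(geq_leqif (mxrank_leqif_sup vker)) rank1 rank_rV.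
case: eqP => // v0; have := v_neq0 0; by rewrite v0 mxE eqxx.
Qed.

(* The kernel is a line stable under the shift, so a kernel vector is geometric. *)
Lemma nut_alternating (R : realFieldType) m (S : {set 'I_m.+1}) :
  nut_graph R (Circ S) -> (0 < #|connection_set S|)%N ->
  ~~ odd m.+1 /\ \sum_(d in connection_set S) (-1) ^+ d = 0 :> R.
Proof.
set N := connection_set S.
move=> /nut_kernel[v [vN v_neq0 v_span]] N0.
(* The shift of [v] is again in the kernel, so it is [c] times [v]. *)
pose u : 'rV[R]_m.+1 := \row_i v 0 (i + inZp 1).
have [|c uE] := v_span u.
  apply/rowP => j; rewrite mul_circmxE !mxE.
  under eq_bigr do rewrite mxE addrAC.
  by rewrite -mul_circmxE vN mxE.
have vE k : v 0 (inZp k) = c ^+ k * v 0 0.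
  elim: k => [|k IHk]; first by rewrite mul1r; congr (v 0 _); apply: val_inj.
  have -> : inZp k.+1 = inZp k + inZp 1 :> 'I_m.+1.
    by apply/val_inj; rewrite /= modnDm addn1.
  by have /rowP/(_ (inZp k)) := uE; rewrite !mxE IHk exprS mulrA.
have cn : c ^+ m.+1 = 1.
  apply: (mulIf (v_neq0 0)); rewrite -vE mul1r; congr (v 0 _).
  by apply/val_inj; rewrite /= modnn.
have sumN : \sum_(d in N) c ^+ d = 0.
  apply: (mulIf (v_neq0 0)); rewrite mul0r mulr_suml.
  have /rowP/(_ 0) := vN; rewrite mul_circmxE mxE => sumv; rewrite -[RHS]sumv.
  rewrite [RHS](reindex_inj oppr_inj) /=.
  apply: eq_big => [d|d _]; first by rewrite connection_setN.
  by rewrite opprK add0r -vE valZpK.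
(* In an ordered field the only candidates are 1 and -1; the former would make the sum the degree,
   which is positive. *)
have : `|c| == 1.
  by rewrite -(@pexpr_eq1 _ `|c| m.+1) // -normrX cn normr1.
rewrite eqr_norml ler01 andbT => /orP[]/eqP cE; last first.
  split; last by rewrite -cE.
  apply/negP => n_odd; move/eqP: cn; rewrite cE -signr_odd n_odd.
  by rewrite eqNr oner_eq0.
move/eqP: sumN; rewrite cE; under eq_bigr do rewrite expr1n.
by rewrite sumr_const pnatr_eq0 eqn0Ngt N0.
Qed.

(* The congruences say that the kernel contains the vector with entries [1] at the
   multiples of [2 p], [-1] at [p] modulo [2 p], and [0] elsewhere. *)
Definition sparse_kernel n (b : seq bool) p :=
  all (fun j =>
    count (fun i => (2 * p %| i) && nth false b ((j + (n - i)) %% n))%N (iota 0 n) ==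
    count (fun i => (i %% (2 * p) == p) && nth false b ((j + (n - i)) %% n))%N (iota 0 n))
  (iota 0 n).

Lemma count_iota n (P : pred nat) : count P (iota 0 n) = #|[pred i : 'I_n | P i]|.
Proof. by rewrite -sum1_count -sum1_card -[RHS](big_mkord P (fun=> 1%N)) /index_iota subn0. Qed.

Lemma sum_natr_bool (R : pzRingType) (T : finType) (P : pred T) :
  \sum_i (P i)%:R = #|P|%:R :> R.
Proof.
by rewrite -sum1_card natr_sum [RHS]big_mkcond; apply: eq_bigr => i _; rewrite unfold_in; case: (P i).
Qed.

(** The sparse vector has entry 1 at 0 and entry 0 at 1, so it is no multiple of a vector without
    zero entries. *)
Lemma nut_not_sparse (R : realFieldType) m (S : {set 'I_m.+1}) b p :
  (forall i : 'I_m.+1, (i \in connection_set S) = nth false b i) ->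
  (1 < p)%N -> nut_graph R (Circ S) -> ~~ sparse_kernel m.+1 b p.
Proof.
move=> bE p1 S_nut; have [v [_ v_neq0 v_span]] := nut_kernel S_nut.
apply/negP => sparse.
pose u : 'rV[R]_m.+1 := \row_i ((2 * p %| i)%:R - (i %% (2 * p) == p)%N%:R).
have [|c uE] := v_span u.
  apply/rowP => j; rewrite !mxE.
  under eq_bigr do rewrite !mxE bE mulrBl -!natrM !mulnb.
  rewrite sumrB !sum_natr_bool.
  have := allP sparse j; rewrite mem_iota ltn_ord !count_iota => /(_ isT)/eqP sparse_j.
  apply/eqP; rewrite subr_eq0; apply/eqP; congr (_%:R).
  by apply: etrans (etrans sparse_j _); apply: eq_card => i; rewrite !unfold_in /= modnDmr.
have m0 : (0 < m)%N by case: S_nut.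
have /rowP/(_ 0) := uE; have /rowP/(_ (inord 1)) := uE.
rewrite !mxE inordK // dvdn0 mod0n dvdn1 modn_small; last by lia.
have -> : (2 * p == 1)%N = false by lia.
have -> : (1 == p)%N = false by lia.
have -> : (0 == p)%N = false by lia.
move=> /esym/eqP; rewrite subrr mulf_eq0 (negbTE (v_neq0 _)) orbF => /eqP->.
by move/eqP; rewrite subr0 mul0r oner_eq0.
Qed.

(** Indexing by the distance [minn k (n - k)] to 0 encodes symmetry and leaves at most 2^8 sets to
    enumerate. *)
Lemma small_order_sparse n (c : nat -> bool) :
  let b := mkseq (fun k => (0 < k)%N && c (minn k (n - k))) n in
  n \in [:: 10; 12; 16]%N -> count id b = 8 ->
  count (fun i => nth false b i && odd i) (iota 0 n) =
    count (fun i => nth false b i && ~~ odd i) (iota 0 n) ->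
  has (sparse_kernel n b) [:: 2; 4; 5; 8].
Proof.
move=> b; rewrite /b !inE => /or3P[]/eqP-> {b}; rewrite /mkseq /= /minn /=;
move: (c 1) (c 2) (c 3) (c 4) (c 5) (c 6) (c 7) (c 8) => {c}.
- by do 5![case]; vm_compute.
- by do 6![case]; vm_compute.
- by do 8![case]; vm_compute.
Qed.

Lemma nut_order_necessary (R : realFieldType) n (S : {set 'I_n}) :
  (0 < n)%N -> regular_graph 8 (Circ S) -> nut_graph R (Circ S) ->
  ~~ odd n /\ (n = 14 \/ (18 <= n)%N).
Proof.
case: n S => // m S _ S_reg S_nut; have := S_reg 0; rewrite card_Circ => cardN.
have [n_even sumN] : ~~ odd m.+1 /\ \sum_(d in connection_set S) (-1) ^+ d = 0 :> R.
  by apply: nut_alternating; rewrite ?cardN.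
have N0 : 0 \notin connection_set S.
  by case: S_nut => _ /(_ 0) irr *; rewrite -(subrr 0) -CircE irr.
(* The eight elements of the connection set all differ from 0. *)
have n9 : (8 < m.+1)%N.
  rewrite -cardN -[X in (_ < X)%N]card_ord -cardsT proper_card // properEneq subsetT andbT.
  by apply: contraNneq N0 => ->; rewrite inE.
split=> //; have [n18|n18] := leqP 18 m.+1; [by right|left].
apply/eqP/contraT => n14.
pose b k := inZp k \in connection_set S.
have bE (i : 'I_m.+1) : (i \in connection_set S) = nth false (mkseq b m.+1) i.
  by rewrite nth_mkseq // /b valZpK.
have b_sym k : (k <= m)%N -> b (m.+1 - k)%N = b k.
  move=> k_le; rewrite /b -[RHS]connection_setN.
  suff -> : inZp (m.+1 - k) = - inZp k :> 'I_m.+1 by [].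
  by apply/val_inj; rewrite /= (@modn_small k).
have LE : mkseq b m.+1 = mkseq (fun k => (0 < k)%N && b (minn k (m.+1 - k))) m.+1.
  apply/eq_in_map => -[|k]; rewrite mem_iota => /andP[_ k_lt] /=.
    by rewrite /b (_ : inZp 0 = 0) ?(negbTE N0) //; apply/val_inj.
  by rewrite /minn; case: ifP => // _; rewrite b_sym.
have cardE (P : pred nat) :
    count (fun i => nth false (mkseq b m.+1) i && P i) (iota 0 m.+1) =
    #|[set i in connection_set S | P (val i)]|.
  by rewrite count_iota; apply: eq_card => i; rewrite [RHS]inE bE.
have b8 : count id (mkseq b m.+1) = 8.
  rewrite count_map -[RHS]cardN count_iota; apply: eq_card => i.
  by rewrite inE /= /b valZpK.
(* The vanishing alternating sum, restated as a count by parity. *)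
have b_bal : count (fun i => nth false (mkseq b m.+1) i && odd i) (iota 0 m.+1) =
    count (fun i => nth false (mkseq b m.+1) i && ~~ odd i) (iota 0 m.+1).
  have cardR (P : pred nat) : #|[set i in connection_set S | P (val i)]|%:R =
      \sum_(i in connection_set S) (P i)%:R :> R.
    rewrite -sum1_card natr_sum big_mkcond [RHS]big_mkcond; apply: eq_bigr => i _.
    by rewrite [i \in finset _]inE; case: (i \in _) => //; case: (P _).
  apply/eqP; rewrite !cardE -(eqr_nat R) (cardR odd) (cardR (fun k => ~~ odd k)) eq_sym -subr_eq0 -sumrB.
  apply/eqP; rewrite -[RHS]sumN; apply: eq_bigr => i _.
  by rewrite -signr_odd; case: odd; rewrite /= ?subr0 ?sub0r.
have : has (sparse_kernel m.+1 (mkseq b m.+1)) [:: 2; 4; 5; 8].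
  move: b8 b_bal; rewrite LE; apply: small_order_sparse.
  (* The even orders from 9 to 17 other than 14 are 10, 12 and 16. *)
  rewrite !inE; lia.
case/hasP => p p_in; rewrite (negbTE (nut_not_sparse bE _ S_nut)) //.
by move: p_in; rewrite !inE; lia.
Qed.

End Circulant.

Theorem proposition18 (R : realFieldType) (n : nat) (n_gt0 : (0 < n)%N) :
  (exists S : {set 'I_n},
      [/\ generator_set S, regular_graph 8 (Circ S) & nut_graph R (Circ S)])
  <->
  (~~ odd n /\ (n = 14 \/ (18 <= n)%N)).
Proof.
split=> [[S [_ S_reg S_nut]]|[n_even n_ge]].
  exact: nut_order_necessary S_reg S_nut.
exact: nut_order_sufficient.
Qed.
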